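(* Let $X$ be a connected and finite Helly complex, and let $\partial X$ be its combinatorial boundary. Equip the vertex set $V(\partial X)$ with the metric induced from $d_X$. Then there is a graph isomorphism $$G(X)\cong \mathrm{Helly}(\partial X).$$ More precisely, the boundary-distance map $$\Phi : V(X)\to \mathrm{Helly}(\partial X), \qquad \Phi(x) = \big(b\mapsto d_X(x,b)\big)\quad (b\in V(\partial X)),$$ is well defined (each $\Phi(x)$ is a vertex of $\mathrm{Helly}(\partial X)$) and induces such an isomorphism of graphs. Under this identification, the restriction of $\Phi$ to $V(\partial X)$ is the canonical embedding $\iota_{\partial X}: V(\partial X)\to \mathrm{Helly}(\partial X)$, $\iota_{\partial X}(b) = d_X(b,\cdot)$.
   Context: Simplicial complexes. A (finite) simplicial complex $X$ is a set of nonempty subsets (simplices) of a finite set such that any nonempty subset of a simplex is a simplex. The dimension of a simplex $\sigma$ is $|\sigma|-1$. If $\sigma$ has dimension $k$, its facets are the simplices of dimension $k-1$ contained in $\sigma$. A simplex is maximal if it is maximal by inclusion, and non-maximal otherwise. $V(X)$ is the set of vertices ($0$-simplices), and $G(X)=X^{(1)}$ is the $1$-skeleton, viewed as a graph (two distinct vertices are adjacent iff they form a simplex). $X$ is connected if $G(X)$ is connected; connected complexes are taken to be nonempty. For connected $X$, $d_X(u,v)$ is the least number of edges of a $(u,v)$-path in $G(X)$. Helly complexes. A Helly graph is a connected graph in which every collection of pairwise intersecting balls (for the graph distance) has nonempty intersection. The clique complex of a graph is the simplicial complex whose simplices are the vertex sets of the (nonempty) cliques of the graph. A Helly complex is the clique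 complex of a Helly graph. Combinatorial boundary. $\partial X$ is the downward closure (all nonempty subsets) of the set of all non-maximal simplices of $X$ that are a facet of exactly one simplex of $X$. Convention: if $X$ consists of a single vertex, then $\partial X = X$. $\partial X$ is regarded as the metric space with underlying set $V(\partial X)$ and distance the restriction of $d_X$ (not the path metric of $\partial X$). Hellyfication. Let $(B,d)$ be a finite metric space with integer-valued distance. An integer metric form on $B$ is a function $f:B\to\mathbb{Z}$ with $f(a)+f(b)\ge d(a,b)$ for all $a,b\in B$ (including $a=b$). Order integer metric forms pointwise: $f\le g$ iff $f(x)\le g(x)$ for every $x\in B$. An integer metric form $f$ is extremal if it is minimal: whenever $g$ is an integer metric form with $g\le f$, then $g=f$. $\mathrm{Helly}(B)=E^0(B)$ is the graph whose vertices are the extremal integer metric forms on $B$, with $f\sim g$ iff $d_\infty(f,g)=\max_{b\in B}|f(b)-g(b)|=1$. The canonical map is $\iota_B:B\to E^0(B)$, $b\mapsto d(b,\cdot)$. *)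

(* Defs.v *)
From mathcomp Require Import all_boot all_order all_algebra.
From mathcomp Require Import boolp.

Set Implicit Arguments.
Unset Strict Implicit.
Unset Printing Implicit Defensive.

Import Order.TTheory GRing.Theory Num.Theory.

(* The vertex set is a predicate on an ambient type, so that the 1-skeleton   *)
(* of a complex and a graph of integer-valued functions have the same type.   *)
Record sgraph (T : Type) := SGraph {
  verts : {pred T};
  edge : rel T;
  edge_sym : symmetric edge;
  edge_irr : irreflexive edge;
  edge_verts : forall x y, edge x y -> x \in verts
}.

Definition is_graph_iso (S T : Type) (G : sgraph S) (H : sgraph T)
    (F : S -> T) : Prop :=
  [/\ {in verts G, forall x, F x \in verts H},
      {in verts G &, injective F},
      {in verts H, forall y, exists2 x, x \in verts G & F x = y}
    & {in verts G &, forall x y, edge H (F x) (F y) = edge G x y}].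

Definition isomorphic (S T : Type) (G : sgraph S) (H : sgraph T) : Prop :=
  exists F : S -> T, is_graph_iso G H F.

Section Distance.
Variables (T : finType) (G : sgraph T).
Implicit Types (u v w : T) (n : nat) (p : seq T).

Definition has_walk u v n : bool :=
  [exists p : n.-tuple T, path (edge G) u p && (last u p == v)].

Lemma has_walkP u v n :
  reflect (exists p, [/\ size p = n, path (edge G) u p & last u p = v])
          (has_walk u v n).
Proof.
apply: (iffP existsP) => [[p /andP[pp /eqP lp]]|[p [sp pp lp]]].
  by exists p; rewrite size_tuple.
move/eqP: sp => sp; exists (Tuple sp) => /=.
by rewrite pp lp eqxx.
Qed.

Lemma connect_walk u v : connect (edge G) u v -> exists n, has_walk u v n.
Proof.
by case/connectP=> p pp ->; exists (size p); apply/has_walkP; exists p.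
Qed.

(* Junk value 0 when u and v lie in different components.                     *)
Definition gdist u v : nat :=
  if @idP (connect (edge G) u v) is ReflectT uv then ex_minn (connect_walk uv)
  else 0.

Lemma gdistP u v : connect (edge G) u v ->
  has_walk u v (gdist u v) /\ forall n, has_walk u v n -> gdist u v <= n.
Proof.
move=> uv; rewrite /gdist; case: {-}_ / idP => [uv'|//].
by case: ex_minnP => m wm min_m; split.
Qed.

Definition gconnected : Prop :=
  (exists x, x \in verts G) /\ {in verts G &, forall u v, connect (edge G) u v}.

Definition ball (c : T) (r : nat) : {set T} :=
  [set y | (y \in verts G) && (gdist c y <= r)].

Definition is_ball (A : {set T}) : Prop :=
  exists c r, c \in verts G /\ A = ball c r.

Definition helly_graph : Prop :=
  gconnected /\
  forall F : {set {set T}},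
    {in F, forall A, is_ball A} ->
    {in F &, forall A B, A :&: B != set0} ->
    exists2 x, x \in verts G & {in F, forall A : {set T}, x \in A}.

End Distance.

Record complex (T : finType) := Complex {
  simplices : {set {set T}};
  simplex_neq0 : set0 \notin simplices;
  simplex_sub : forall s t : {set T},
    t \in simplices -> s \subset t -> s != set0 -> s \in simplices
}.

Section Complexes.
Variable T : finType.
Implicit Types (X : complex T) (s t : {set T}).

Definition vertices X : {set T} := [set x | [set x] \in simplices X].

Definition skel_edge X : rel T :=
  [rel x y | (x != y) && ([set x; y] \in simplices X)].

Lemma skel_edge_sym X : symmetric (skel_edge X).
Proof. by move=> x y; rewrite /skel_edge /= eq_sym setUC. Qed.

Lemma skel_edge_irr X : irreflexive (skel_edge X).
Proof. by move=> x; rewrite /skel_edge /= eqxx. Qed.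

Lemma skel_edge_verts X x y : skel_edge X x y -> x \in mem (vertices X).
Proof.
case/andP=> _ xyX; rewrite /= inE; apply: simplex_sub xyX _ _.
  by rewrite subsetUl.
by apply/set0Pn; exists x; rewrite inE.
Qed.

Definition skeleton X : sgraph T :=
  SGraph (@skel_edge_sym X) (@skel_edge_irr X) (@skel_edge_verts X).

Definition is_clique (G : sgraph T) s : bool :=
  [forall x in s, x \in verts G] &&
  [forall x in s, [forall y in s, (x != y) ==> edge G x y]].

Definition cliques (G : sgraph T) : {set {set T}} :=
  [set s | (s != set0) && is_clique G s].

Lemma cliques_neq0 (G : sgraph T) : set0 \notin cliques G.
Proof. by rewrite inE eqxx. Qed.

Lemma cliques_sub (G : sgraph T) s t :
  t \in cliques G -> s \subset t -> s != set0 -> s \in cliques G.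
Proof.
rewrite !inE => /andP[_ /andP[/forall_inP tV /forall_inP tE]] /subsetP st ->.
rewrite andTb; apply/andP; split; first by apply/forall_inP => x /st /tV.
apply/forall_inP => x /st /tE /forall_inP xE.
by apply/forall_inP => y /st /xE.
Qed.

Definition clique_complex (G : sgraph T) : complex T :=
  Complex (cliques_neq0 G) (@cliques_sub G).

Definition helly_complex X : Prop :=
  exists2 G : sgraph T, helly_graph G & simplices X = simplices (clique_complex G).

Definition dim s : nat := #|s| - 1.

Definition facet X s t : bool :=
  [&& s \in simplices X, t \in simplices X, s \subset t
    & dim t == (dim s).+1].

Definition free_faces X : {set {set T}} :=
  [set s in simplices X |
     ~~ maxset [in simplices X] s & #|[set t | facet X s t]| == 1].

Definition boundary_set X : {set {set T}} :=
  if [exists v, simplices X == [set [set v]]] then simplices X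
  else [set s | (s != set0) && [exists t in free_faces X, s \subset t]].

Lemma boundary_neq0 X : set0 \notin boundary_set X.
Proof.
by rewrite /boundary_set; case: ifP => _; [exact: simplex_neq0|rewrite inE eqxx].
Qed.

Lemma boundary_sub X s t :
  t \in boundary_set X -> s \subset t -> s != set0 -> s \in boundary_set X.
Proof.
rewrite /boundary_set; case: ifP => _; first exact: simplex_sub.
rewrite !inE => /andP[_ /exists_inP[r rX tr]] st ->.
by apply/exists_inP; exists r => //; exact: subset_trans tr.
Qed.

Definition boundary X : complex T :=
  Complex (boundary_neq0 X) (@boundary_sub X).

Definition boundary_vertex X : finType :=
  {x : T | x \in vertices (boundary X)}.

Definition boundary_dist X (a b : boundary_vertex X) : int :=
  (gdist (skeleton X) (val a) (val b))%:Z.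

End Complexes.

Local Open Scope ring_scope.

Definition is_metric (B : Type) (d : B -> B -> int) : Prop :=
  [/\ forall a b, 0 <= d a b, forall a b, d a b = 0 <-> a = b,
      forall a b, d a b = d b a
    & forall a b c, d a c <= d a b + d b c].

Section Hellyfication.
Variables (B : finType) (d : B -> B -> int).
Implicit Types f g : {ffun B -> int}.

Definition metric_form f : Prop := forall a b, d a b <= f a + f b.

Definition extremal f : Prop :=
  metric_form f /\
  forall g, metric_form g -> (forall x, g x <= f x) -> g = f.

Definition dinfty f g : nat := \max_(b : B) `|f b - g b|%N.

Definition helly_edge : rel {ffun B -> int} :=
  [rel f g | [&& `[< extremal f >], `[< extremal g >] & dinfty f g == 1%N]].

Lemma helly_edge_sym : symmetric helly_edge.
Proof.
move=> f g; rewrite /helly_edge /= andbCA; congr [&& _, _ & _ == _].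
by apply: eq_bigr => b _; rewrite distnC.
Qed.

Lemma helly_edge_irr : irreflexive helly_edge.
Proof.
move=> f; rewrite /helly_edge /= /dinfty big1 ?andbF // => b _.
by rewrite subrr.
Qed.

Lemma helly_edge_verts f g :
  helly_edge f g -> f \in [pred h | `[< extremal h >]].
Proof. by case/andP. Qed.

Definition hellyfication : sgraph {ffun B -> int} :=
  SGraph helly_edge_sym helly_edge_irr helly_edge_verts.

Definition canonical_map (b : B) : {ffun B -> int} := [ffun x => d b x].

End Hellyfication.

Lemma canonical_map_extremal (B : finType) (d : B -> B -> int) (b : B) :
  is_metric d -> canonical_map d b \in verts (hellyfication d).
Proof.
move=> [d0 deq dsym dtri]; apply/asboolP; split=> [x y|g gform gle].
  by rewrite !ffunE (dsym b x).
have gb : g b = 0.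
  have bb : d b b = 0 by apply/deq.
  apply/eqP; rewrite eq_le; move: (gle b) (gform b b); rewrite !ffunE bb.
  by rewrite -mulr2n pmulrn_lge0 // => -> ->.
apply/ffunP => x; apply/eqP; rewrite eq_le gle ffunE.
by have := gform b x; rewrite gb add0r => ->.
Qed.

Lemma boundary_dist_metric (T : finType) (X : complex T) :
  gconnected (skeleton X) -> is_metric (@boundary_dist T X).
Proof.
move=> [_ conX].
have bX (a : boundary_vertex X) : val a \in verts (skeleton X).
  have := valP a; rewrite !inE /= /boundary_set; case: ifP => // _.
  rewrite inE => /andP[a0 /exists_inP[t]].
  by rewrite inE => /andP[tX _] at_; exact: simplex_sub tX at_ a0.
have cX (a b : boundary_vertex X) : connect (edge (skeleton X)) (val a) (val b).
  by apply: conX; exact: bX.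
have le_sym (a b : boundary_vertex X) :
    (gdist (skeleton X) (val a) (val b) <= gdist (skeleton X) (val b) (val a))%N.
  have [/has_walkP[p [sp pp lp]] _] := gdistP (cX b a).
  have [_ -> //] := gdistP (cX a b).
  apply/has_walkP; exists (rev (belast (val b) p)).
  rewrite size_rev size_belast sp -lp rev_path; split=> //.
    by rewrite (eq_path (e' := edge (skeleton X))) // => x y; exact: edge_sym.
  by case: (p) => //= x q; rewrite rev_cons last_rcons.
split=> [//|a b|a b|a b c].
- split=> [[ab]|->].
    have [/has_walkP[p []]] := gdistP (cX a b).
    by rewrite ab => /size0nil -> _ /= /val_inj.
  have [_ m] := gdistP (cX b b); apply/eqP; rewrite eqz_nat -leqn0; apply: m.
  by apply/has_walkP; exists [::].
- by congr Posz; apply/eqP; rewrite eqn_leq !le_sym.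
- rewrite /boundary_dist -PoszD lez_nat.
  have [/has_walkP[p [sp pp lp]] _] := gdistP (cX a b).
  have [/has_walkP[q [sq pq lq]] _] := gdistP (cX b c).
  have [_ -> //] := gdistP (cX a c); apply/has_walkP; exists (p ++ q).
  by rewrite size_cat sp sq cat_path pp last_cat lp pq lq.
Qed.

Definition boundary_map (T : finType) (X : complex T) (x : T) :
    {ffun boundary_vertex X -> int} :=
  [ffun b => (gdist (skeleton X) x (val b))%:Z].

(* Main.v *)
Require Import Defs.
From mathcomp Require Import all_boot all_order all_algebra.
From mathcomp Require Import boolp zify.

(** Everything rests on an extension property of a finite Helly graph G: given
    vertices x and y, some boundary vertex b satisfies
    d(x, b) = d(x, y) + d(y, b).

    To see this, push y away from x along geodesics until it is stuck at a
    vertex b, all of whose neighbours are at distance at most n = d(x, b) from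
    x.  If n > 0, the ball of radius n - 1 about x and the unit balls about the
    vertices of the closed neighbourhood N[b] pairwise intersect, so the Helly
    property gives a vertex w, distinct from b, with N[b] contained in N[w]
    ([stuck_vertex_dominated]).  A maximal clique t through b then contains w,
    and any vertex completing t - w to a larger clique is adjacent to b, hence
    adjacent or equal to w, hence in t.  So t is the only simplex having t - w
    as a facet, and b lies in the boundary
    ([dominated_vertex_in_boundary]).  If n = 0 then b is isolated and G is a
    single vertex, which is its own boundary by convention.

    The extension property makes Phi an isometry for the sup distance, since
    d(x, b) - d(y, b) reaches d(x, y), and it makes Phi(x) extremal, since every
    boundary vertex a has a partner b with d(a, b) = d(a, x) + d(x, b).
    Conversely, for an integer metric form f the balls of radius f(b) about the
    boundary vertices b pairwise intersect; a common point x gives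
    Phi(x) <= f, and this is an equality when f is extremal. *)

Set Implicit Arguments.
Unset Strict Implicit.
Unset Printing Implicit Defensive.

Import Order.TTheory GRing.Theory Num.Theory.

(** * Distances in a connected graph *)

Section GraphDistance.
Variables (T : finType) (G : sgraph T).
Implicit Types u v w : T.

Lemma edge_verts_r u v : edge G u v -> v \in verts G.
Proof. by rewrite edge_sym; apply: edge_verts. Qed.

Lemma path_verts u p : u \in verts G -> path (edge G) u p -> last u p \in verts G.
Proof.
by elim: p u => //= v p IH u _ /andP[uv]; apply: IH; exact: edge_verts_r uv.
Qed.

Lemma has_walk_cat u v w m n :
  has_walk G u v m -> has_walk G v w n -> has_walk G u w (m + n).
Proof.
move=> /has_walkP[p [sp pp lp]] /has_walkP[q [sq pq lq]].
apply/has_walkP; exists (p ++ q).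
by rewrite size_cat sp sq cat_path pp last_cat lp pq lq.
Qed.

Lemma has_walk_sym u v n : has_walk G u v n -> has_walk G v u n.
Proof.
move=> /has_walkP[p [sp pp lp]]; apply/has_walkP.
exists (rev (belast u p)); rewrite size_rev size_belast -lp rev_path; split=> //.
  by rewrite (eq_path (e' := edge G)) // => x y; exact: edge_sym.
by case: (p) => //= x q; rewrite rev_cons last_rcons.
Qed.

Hypothesis conG : gconnected G.

Lemma gconnectedP u v : u \in verts G -> v \in verts G -> connect (edge G) u v.
Proof. exact: conG.2. Qed.

Lemma gdist_walk u v :
  u \in verts G -> v \in verts G -> has_walk G u v (gdist G u v).
Proof. by move=> uG vG; case: (gdistP (gconnectedP uG vG)). Qed.

Lemma gdist_min u v n :
  u \in verts G -> v \in verts G -> has_walk G u v n -> gdist G u v <= n.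
Proof. by move=> uG vG; case: (gdistP (gconnectedP uG vG)) => _; apply. Qed.

Lemma gdist_sym u v :
  u \in verts G -> v \in verts G -> gdist G u v = gdist G v u.
Proof.
by move=> uG vG; apply/eqP; rewrite eqn_leq !gdist_min //;
  apply: has_walk_sym; apply: gdist_walk.
Qed.

Lemma gdist_triangle v u w : u \in verts G -> v \in verts G -> w \in verts G ->
  gdist G u w <= gdist G u v + gdist G v w.
Proof.
move=> uG vG wG; apply: gdist_min => //.
exact: has_walk_cat (gdist_walk uG vG) (gdist_walk vG wG).
Qed.

Lemma gdist_eq0 u v :
  u \in verts G -> v \in verts G -> (gdist G u v == 0) = (u == v).
Proof.
move=> uG vG; apply/eqP/eqP => [d0|<-].
  by have /has_walkP[p [/size0nil-> _ /=]] : has_walk G u v 0 by rewrite -d0 gdist_walk.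
by apply/eqP; rewrite -leqn0 gdist_min //; apply/has_walkP; exists [::].
Qed.

Lemma gdist_eq1 u v :
  u \in verts G -> v \in verts G -> (gdist G u v == 1) = edge G u v.
Proof.
move=> uG vG; apply/eqP/idP => [d1|uv].
  have : has_walk G u v 1 by rewrite -d1 gdist_walk.
  by move=> /has_walkP[[|w [|? ?]] [// _ /= /andP[uw _] <-]].
apply/eqP; rewrite eqn_leq lt0n gdist_eq0 //; apply/andP; split.
  by apply: gdist_min => //; apply/has_walkP; exists [:: v]; rewrite /= uv.
by apply: contraTneq uv => ->; rewrite edge_irr.
Qed.

Lemma gdist_le1 u v : u \in verts G -> v \in verts G ->
  (gdist G u v <= 1) = (u == v) || edge G u v.
Proof. by move=> uG vG; rewrite -gdist_eq0 // -gdist_eq1 //; lia. Qed.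

(** A walk can be cut after m steps; this is what makes balls whose centres are
    close enough to each other meet. *)
Lemma gdist_split u v m n : u \in verts G -> v \in verts G ->
  gdist G u v <= m + n ->
  exists w, [/\ w \in verts G, gdist G u w <= m & gdist G w v <= n].
Proof.
move=> uG vG duv; have /has_walkP[p [sp pp lp]] := gdist_walk uG vG.
move: pp; rewrite -(cat_take_drop m p) cat_path => /andP[pt pd].
have wG := path_verts uG pt.
exists (last u (take m p)); split=> //.
  apply: leq_trans (gdist_min uG wG _) (geq_minl m (size p)).
  by apply/has_walkP; exists (take m p); rewrite size_take_min.
have lenle : size (drop m p) <= n by rewrite size_drop sp leq_subLR.
apply: leq_trans (gdist_min wG vG _) lenle.
apply/has_walkP; exists (drop m p); split=> //.
by rewrite -last_cat cat_take_drop.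
Qed.

Lemma mem_ball c r u : (u \in ball G c r) = (u \in verts G) && (gdist G c u <= r).
Proof. by rewrite inE. Qed.

Lemma ball_meet u v m n : u \in verts G -> v \in verts G ->
  gdist G u v <= m + n -> ball G u m :&: ball G v n != set0.
Proof.
move=> uG vG /(gdist_split uG vG)[w [wG uw wv]].
by apply/set0Pn; exists w; rewrite inE !mem_ball wG uw /= gdist_sym.
Qed.

End GraphDistance.

Lemma gdist_disconnected (T : finType) (G : sgraph T) u v :
  ~~ connect (edge G) u v -> gdist G u v = 0.
Proof. by move=> nuv; rewrite /gdist; case: {-}_ / idP => // uv; case/negP: nuv. Qed.

Lemma eq_gdist (T : finType) (G H : sgraph T) u v :
  edge G =2 edge H -> gdist G u v = gdist H u v.
Proof.
move=> eGH; have eW n : has_walk G u v n = has_walk H u v n.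
  by apply: eq_existsb => p; rewrite (eq_path eGH).
have eC := eq_connect eGH u v.
have [cG|ncG] := boolP (connect (edge G) u v).
  have [wG mG] := gdistP cG; move: cG; rewrite eC => /gdistP[wH mH].
  by apply/eqP; rewrite eqn_leq mG ?mH -?eW // eW.
by rewrite !gdist_disconnected // -eC.
Qed.

(** * Helly graphs *)

Section HellyGraph.
Variables (T : finType) (G : sgraph T).
Hypothesis hellyG : helly_graph G.
Let conG : gconnected G := hellyG.1.

Lemma helly_common_point (I : finType) (A : pred I) (c : I -> T) (r : I -> nat) :
  (forall i, A i -> c i \in verts G) ->
  (forall i j, A i -> A j -> gdist G (c i) (c j) <= r i + r j) ->
  exists2 x, x \in verts G & forall i, A i -> gdist G (c i) x <= r i.
Proof.
move=> cG rA; have [||x xG xF] := hellyG.2 [set ball G (c i) (r i) | i in A].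
- by move=> _ /imsetP[i Ai ->]; exists (c i), (r i); split=> //; apply: cG.
- move=> _ _ /imsetP[i Ai ->] /imsetP[j Aj ->].
  by apply: ball_meet => //; [exact: cG|exact: cG|exact: rA].
exists x => // i Ai; have := xF _ (imset_f (fun i => ball G (c i) (r i)) Ai).
by rewrite mem_ball => /andP[].
Qed.

(** The vertex w is a common point of the ball of radius d(x, y) - 1 about x and
    the unit balls about the closed neighbourhood of y.  The first ball meets
    the others because no neighbour of y is farther from x than y is, and it
    keeps w different from y. *)
Lemma stuck_vertex_dominated x y : x \in verts G -> y \in verts G -> x != y ->
  (forall z, edge G y z -> gdist G x z <= gdist G x y) ->
  exists2 w, edge G y w & forall z, edge G y z -> (w == z) || edge G w z.
Proof.
move=> xG yG xy stuck; set n := gdist G x y.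
have n0 : 0 < n by rewrite lt0n gdist_eq0.
(* The index None stands for the ball about x, Some z for the one about z. *)
pose c (o : option T) := odflt x o; pose r (o : option T) := if o is Some _ then 1 else n.-1.
pose A (o : option T) := if o is Some z then (y == z) || edge G y z else true.
have NG z : (y == z) || edge G y z -> z \in verts G.
  by case/orP=> [/eqP<- //|yz]; exact: edge_verts_r yz.
have Nn z : (y == z) || edge G y z -> gdist G x z <= n.
  by case/orP=> [/eqP<- //|/stuck].
have N1 z : (y == z) || edge G y z -> gdist G y z <= 1.
  by move=> yz; rewrite gdist_le1 // NG.
have [||w wG wA] := helly_common_point (A := A) (c := c) (r := r).
- by case.
- move=> [z|] [z'|]; rewrite /A /c /r /= => Az Az'.
  + have := gdist_triangle conG (NG _ Az) yG (NG _ Az').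
    rewrite (gdist_sym conG (NG _ Az) yG).
    by move: (N1 _ Az) (N1 _ Az'); lia.
  + by rewrite (gdist_sym conG (NG _ Az) xG); move: (Nn _ Az); lia.
  + by move: (Nn _ Az'); lia.
  + by have /eqP-> : gdist G x x == 0 by rewrite gdist_eq0.
have yw : edge G y w.
  have := wA (Some y); rewrite /= eqxx gdist_le1 // => /(_ isT)/orP[/eqP yw|//].
  by have := wA None isT; rewrite /= -yw -/n; lia.
exists w => // z yz; have := wA (Some z); rewrite /= yz orbT => /(_ isT).
by rewrite gdist_sym // ?gdist_le1 // (edge_verts_r yz).
Qed.

End HellyGraph.

(** * Helly complexes *)

Lemma cliqueP (T : finType) (H : sgraph T) (s : {set T}) :
  reflect [/\ s != set0, {in s, forall x, x \in verts H}
            & {in s &, forall x y, x != y -> edge H x y}]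
          (s \in cliques H).
Proof.
rewrite inE; apply: (iffP andP) => [[s0 /andP[/forall_inP sV /forall_inP sE]]|].
  by split=> // x y /sE/forall_inP xE /xE/implyP.
move=> [s0 sV sE]; split=> //; apply/andP; split; first exact/forall_inP.
by apply/forall_inP => x xs; apply/forall_inP => y ys; apply/implyP; apply: sE.
Qed.

(** The Helly graph witnessing that X is a Helly complex need only agree with the
    1-skeleton on vertices and edges, so the Helly property, which speaks of
    distances and balls, has to be carried over. *)
Lemma helly_complex_skeleton (T : finType) (X : complex T) : helly_complex X ->
  simplices X = cliques (skeleton X) /\ helly_graph (skeleton X).
Proof.
move=> [G [conG hellyG] XG].
have eV : verts (skeleton X) =i verts G.
  move=> x; rewrite /= inE XG; apply/cliqueP/idP => [[_ + _]|xG].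
    by apply; rewrite inE.
  split; first by apply/set0Pn; exists x; rewrite inE.
    by move=> y /set1P->.
  by move=> y z /set1P-> /set1P->; rewrite eqxx.
have eE : edge (skeleton X) =2 edge G.
  move=> x y; rewrite /= /skel_edge /= XG; apply/andP/idP => [[xy /cliqueP[_ _]]|xy].
    by apply; rewrite ?inE ?eqxx ?orbT.
  split; first by apply: contraTneq xy => ->; rewrite edge_irr.
  apply/cliqueP; split; first by apply/set0Pn; exists x; rewrite !inE eqxx.
    by move=> z /set2P[]->; [exact: edge_verts xy|exact: edge_verts_r xy].
  by move=> a b /set2P[]-> /set2P[]->; rewrite ?eqxx // edge_sym.
have eB c r : ball (skeleton X) c r = ball G c r.
  by apply/setP => y; rewrite !mem_ball eV (eq_gdist _ _ eE).
split.
  rewrite XG; apply/setP => s.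
  by apply/cliqueP/cliqueP => -[s0 sV sE]; split=> // [x /sV|x y xs ys /(sE x y xs ys)];
    rewrite ?eV ?eE.
split.
  have [[x xG] cG] := conG; split; first by exists x; rewrite eV.
  by move=> u v; rewrite !eV (eq_connect eE); exact: cG.
move=> F Fball Fmeet; have [//|x xG xF] := hellyG F _ Fmeet; last first.
  by exists x; rewrite ?eV.
by move=> A /Fball[c [r [cV ->]]]; exists c, r; rewrite -eV eB.
Qed.

(** * The boundary of a flag complex *)

Section Boundary.
Variables (T : finType) (X : complex T).
Local Notation G := (skeleton X).

Lemma boundary_vertex_skeleton (b : boundary_vertex X) : val b \in verts G.
Proof.
have := valP b; rewrite !inE /= /boundary_set; case: ifP => // _.
rewrite inE => /andP[b0 /exists_inP[t]].
by rewrite inE => /andP[tX _] bt; exact: simplex_sub tX bt b0.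
Qed.

Hypothesis flagX : simplices X = cliques G.

Lemma dominated_clique y w (r : {set T}) :
  edge G y w -> (forall z, edge G y z -> (w == z) || edge G w z) ->
  r \in simplices X -> y \in r -> w |: r \in simplices X.
Proof.
rewrite flagX => yw dom /cliqueP[_ rV rE] yr.
have wr z : z \in r -> w != z -> edge G w z.
  move=> zr /negPf wz; have [<-|yz] := eqVneq y z; first by rewrite edge_sym.
  by have := dom z (rE _ _ yr zr yz); rewrite wz.
apply/cliqueP; split.
- by apply/set0Pn; exists w; rewrite setU11.
- by move=> z /setU1P[->|/rV//]; exact: edge_verts_r yw.
- move=> a b /setU1P[->|ar] /setU1P[->|br] //; first by rewrite eqxx.
  + exact: wr.
  + by rewrite eq_sym edge_sym; exact: wr.
  + exact: rE.
Qed.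

(** If t is a maximal simplex through y, the only simplex that has t :\ w as a
    facet is t: adding w to any such simplex gives a simplex containing t, hence
    t itself. *)
Lemma dominated_vertex_in_boundary y w :
  edge G y w -> (forall z, edge G y z -> (w == z) || edge G w z) ->
  y \in vertices (boundary X).
Proof.
move=> yw dom; have yX : [set y] \in simplices X.
  by have := edge_verts yw; rewrite /= inE.
rewrite inE /= /boundary_set; case: ifP => // _; rewrite inE.
have y0 : [set y] != set0 by apply/set0Pn; exists y; rewrite inE.
rewrite y0 /=; have [t tmax] := maxset_exists yX; rewrite sub1set => yt.
have tX : t \in simplices X := maxsetp tmax.
have wt : w \in t.
  by rewrite -(maxsetsup tmax (dominated_clique yw dom tX yt) (subsetUr _ _)) setU11.
have ywneq : y != w by apply: contraTneq yw => ->; rewrite edge_irr.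
have ys : y \in t :\ w by rewrite !inE ywneq.
have s0 : t :\ w != set0 by apply/set0Pn; exists y.
have sX : t :\ w \in simplices X by apply: simplex_sub tX (subsetDl _ _) s0.
have card_t : #|t| = #|t :\ w|.+1 by rewrite (cardsD1 w) wt.
have card_s : 0 < #|t :\ w| by rewrite card_gt0.
apply/exists_inP; exists (t :\ w); last by rewrite sub1set.
rewrite inE sX /=; apply/andP; split.
  apply/negP => /maxsetsup/(_ tX (subsetDl _ _)) /setP/(_ w).
  by rewrite !inE eqxx wt.
apply/cards1P; exists t; apply/setP => r; rewrite !inE /facet sX /=.
apply/idP/eqP => [/and3P[rX sr /eqP drs]|->]; last first.
  by rewrite tX subsetDl /= /Defs.dim card_t !subn1 prednK.
have yr : y \in r := subsetP sr _ ys.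
have tr : t \subset w |: r by rewrite -(setD1K wt) setUS.
apply/eqP; rewrite eqEcard.
rewrite -{1}(maxsetsup tmax (dominated_clique yw dom rX yr) tr) subsetUr /=.
move: drs; rewrite /Defs.dim !subn1 (prednK card_s) card_t => <-.
by rewrite prednK // card_gt0; apply/set0Pn; exists y.
Qed.

Hypothesis hellyX : helly_graph G.
Let conX : gconnected G := hellyX.1.

Lemma isolated_vertex_in_boundary y :
  y \in verts G -> (forall z, ~~ edge G y z) -> y \in vertices (boundary X).
Proof.
move=> yG iso; have Gy z : z \in verts G -> z = y.
  move=> zG; have /connectP[p] := gconnectedP conX yG zG.
  by case: p => [//|u p] /andP[yu]; case/negP: (iso u).
have X1 : simplices X = [set [set y]].
  apply/setP => s; rewrite inE; apply/idP/eqP => [|->]; last by move: yG; rewrite /= inE.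
  rewrite flagX => /cliqueP[s0 sV _]; apply/eqP.
  rewrite eqEsubset; apply/andP; split.
    by apply/subsetP => z /sV/Gy->; rewrite inE.
  by have /set0Pn[z zs] := s0; rewrite sub1set -(Gy z) // sV.
rewrite inE /= /boundary_set ifT; first by rewrite X1 inE.
by apply/existsP; exists y; rewrite X1.
Qed.

(** Among the vertices z such that some geodesic from x to z passes through y, one
    farthest from x has no neighbour farther away, so the domination argument
    places it in the boundary. *)
Lemma geodesic_extension x y : x \in verts G -> y \in verts G ->
  exists b : boundary_vertex X,
    gdist G x (val b) = gdist G x y + gdist G y (val b).
Proof.
move=> xG yG.
pose P z := (z \in verts G) && (gdist G x z == gdist G x y + gdist G y z).
have Py : P y.
  have /eqP yy : gdist G y y == 0 by rewrite gdist_eq0.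
  by rewrite /P yG yy addn0 eqxx.
have [b /andP[bG /eqP xyb] bmax] := @arg_maxnP T y P (gdist G x) Py.
have stuck z : edge G b z -> gdist G x z <= gdist G x b.
  move=> bz; have zG := edge_verts_r bz.
  have /eqP bz1 : gdist G b z == 1 by rewrite gdist_eq1.
  rewrite leqNgt; apply/negP => xbz.
  have Pz : P z.
    rewrite /P zG /=; apply/eqP.
    move: (gdist_triangle conX xG yG zG) (gdist_triangle conX yG bG zG).
    by rewrite bz1; lia.
  by have := bmax z Pz; rewrite /=; lia.
have bB : b \in vertices (boundary X).
  have [exb|xb] := eqVneq x b; last first.
    have [w bw dom] := stuck_vertex_dominated hellyX xG bG xb stuck.
    exact: dominated_vertex_in_boundary bw dom.
  apply: isolated_vertex_in_boundary => // z; apply/negP => bz.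
  have := stuck z bz; rewrite exb (eqP (_ : gdist G b b == 0)) ?gdist_eq0 //.
  rewrite leqn0 gdist_eq0 ?(edge_verts_r bz) // => /eqP bz'.
  by move: bz; rewrite -bz' edge_irr.
by exists (Sub b bB).
Qed.

(** * The boundary-distance map *)

Local Open Scope ring_scope.
Local Notation d := (@boundary_dist T X).

Lemma boundary_map_metric_form x : x \in verts G -> metric_form d (boundary_map X x).
Proof.
move=> xG a b; rewrite !ffunE /boundary_dist.
have aG := boundary_vertex_skeleton a; have bG := boundary_vertex_skeleton b.
have := gdist_triangle conX aG xG bG; rewrite (gdist_sym conX aG xG); lia.
Qed.

(** Extending a geodesic from a boundary vertex a through x gives b with
    d(a, b) = d(a, x) + d(x, b), so a form below Phi(x) cannot drop at a. *)
Lemma boundary_map_extremal x : x \in verts G -> extremal d (boundary_map X x).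
Proof.
move=> xG; split; first exact: boundary_map_metric_form.
move=> g gform gle; apply/ffunP => a; apply/eqP; rewrite eq_le gle /=.
have aG := boundary_vertex_skeleton a.
have [b ab] := geodesic_extension aG xG.
have := gform a b; have := gle b; rewrite !ffunE /boundary_dist ab.
rewrite (gdist_sym conX aG xG) PoszD => gb gab.
by rewrite -(lerD2r (g b)) (le_trans _ gab) // lerD2l.
Qed.

Lemma dinfty_boundary_map x y : x \in verts G -> y \in verts G ->
  dinfty (boundary_map X x) (boundary_map X y) = gdist G x y.
Proof.
move=> xG yG; apply/eqP; rewrite eqn_leq; apply/andP; split.
  apply/bigmax_leqP => b _; rewrite !ffunE.
  have bG := boundary_vertex_skeleton b.
  move: (gdist_triangle conX xG yG bG) (gdist_triangle conX yG xG bG).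
  by rewrite (gdist_sym conX yG xG); lia.
(* At a b extending the geodesic from x to y, the difference is d(x, y). *)
have [b xb] := geodesic_extension xG yG.
have := leq_bigmax (F := fun b => `|boundary_map X x b - boundary_map X y b|%N) b.
by apply: leq_trans; rewrite !ffunE xb PoszD addrK.
Qed.

(** A common point x of the balls of radius f(b) about b satisfies Phi(x) <= f,
    and extremality forces equality. *)
Lemma boundary_map_surjective f : extremal d f ->
  exists2 x, x \in verts G & boundary_map X x = f.
Proof.
move=> [fform fmin].
have f0 b : 0 <= f b.
  by have := fform b b; rewrite /boundary_dist; lia.
have [||x xG xf] := helly_common_point hellyX (A := predT)
    (c := fun b : boundary_vertex X => val b) (r := fun b => `|f b|%N).
- by move=> b _; exact: boundary_vertex_skeleton.
- by move=> a b _ _; move: (fform a b) (f0 a) (f0 b); rewrite /boundary_dist; lia.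
exists x => //; apply: fmin => [|b]; first exact: boundary_map_metric_form.
rewrite ffunE gdist_sym ?boundary_vertex_skeleton //.
by move: (xf b isT) (f0 b); lia.
Qed.

Lemma boundary_map_iso :
  is_graph_iso G (hellyfication d) (@boundary_map T X).
Proof.
split.
- by move=> x xG; apply/asboolP; exact: boundary_map_extremal.
- move=> x y xG yG exy; apply/eqP; rewrite -(gdist_eq0 conX) //.
  rewrite -dinfty_boundary_map // exy /dinfty big1 // => b _.
  by rewrite subrr.
- by move=> f /asboolP; exact: boundary_map_surjective.
- move=> x y xG yG; rewrite /= /helly_edge /= dinfty_boundary_map //.
  by rewrite !asboolT; try exact: boundary_map_extremal; rewrite gdist_eq1.
Qed.

End Boundary.

Theorem theorem1p1 (T : finType) (X : complex T)
    (X_connected : gconnected (skeleton X)) (X_helly : helly_complex X) :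
  [/\ isomorphic (skeleton X) (hellyfication (@boundary_dist T X)),
      {in vertices X, forall x,
        boundary_map X x \in verts (hellyfication (@boundary_dist T X))},
      is_graph_iso (skeleton X) (hellyfication (@boundary_dist T X))
        (@boundary_map T X)
    & forall b : boundary_vertex X,
        boundary_map X (val b) = canonical_map (@boundary_dist T X) b].
Proof.
have [flagX hellyX] := helly_complex_skeleton X_helly.
have iso := boundary_map_iso flagX hellyX.
split=> //; first by exists (@boundary_map T X).
by case: iso.
Qed.
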